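(* Let $\lambda>0$, $T>0$, $L_1,L_2>0$, a function $u_0:\mathbb{R}^2\to\mathbb{R}$, and a pair of nested coarse/fine space-time grids be given as in the context. Let $u_f$ be the fine-grid function produced by Steps 1 and 2 (nonlinear coarse-grid scheme followed by Lagrange interpolation) and let $v_f,w_f$ be the associated fine-grid functions, all as defined in the context. Then the third-step (linear, fine-grid) scheme is uniquely solvable: there exist unique $u^n,v^n,w^n\in\mathcal{V}_h^f$, $0\le n\le N^f$, such that for all $(x_i,y_j)\in\Omega_h^f$, $$\delta_t^f u_{ij}^{n-\frac12}+\psi_h^f\big(u_f^{n-\frac12},u^{n-\frac12}\big)_{ij}-\frac{h_f^2}{2}\Big[\psi_x^f\big(v_f^{n-\frac12},u^{n-\frac12}\big)_{ij}+\psi_y^f\big(w_f^{n-\frac12},u^{n-\frac12}\big)_{ij}\Big]=\lambda\big(v_{ij}^{n-\frac12}+w_{ij}^{n-\frac12}\big),\quad 1\le n\le N^f,$$ $$v_{ij}^n=\delta_{xx}^f u_{ij}^n-\frac{h_f^2}{12}\delta_{xx}^f v_{ij}^n,\qquad w_{ij}^n=\delta_{yy}^f u_{ij}^n-\frac{h_f^2}{12}\delta_{yy}^f w_{ij}^n,\quad 0\le n\le N^f,$$ $$u_{ij}^0=u_0(x_i,y_j).$$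
   Context: **Grids.** $M_1^c,M_2^c,N^c,k_h,k_\tau$ are positive integers with $L_1=h_cM_1^c$, $L_2=h_cM_2^c$ for a common coarse spatial step $h_c>0$, and $\tau_c=T/N^c$. The fine grid has $h_f=h_c/k_h$, $\tau_f=\tau_c/k_\tau$, $M_1^f=k_hM_1^c$, $M_2^f=k_hM_2^c$, $N^f=k_\tau N^c$. For $\sigma\in\{c,f\}$, the grid points are $x_a=ah_\sigma$, $y_b=bh_\sigma$, $t_d=d\tau_\sigma$; $\Omega_h^\sigma=\{(x_a,y_b):1\le a\le M_1^\sigma,\,1\le b\le M_2^\sigma\}$, $\Omega_\tau^\sigma=\{t_d:0\le d\le N^\sigma\}$. $\mathcal{V}_h^\sigma$ is the space of real grid functions $v=\{v_{ab}\}_{a,b\in\mathbb{Z}}$ with $v_{a+M_1^\sigma,b}=v_{ab}$, $v_{a,b+M_2^\sigma}=v_{ab}$. **Difference operators** ($\sigma\in\{c,f\}$). $v_{ab}^{d-\frac12}=\frac12(v_{ab}^d+v_{ab}^{d-1})$, $\delta_t^\sigma v_{ab}^{d-\frac12}=\frac1{\tau_\sigma}(v_{ab}^d-v_{ab}^{d-1})$, $\widehat\delta_x^\sigma v_{ab}=\frac{1}{2h_\sigma}(v_{a+1,b}-v_{a-1,b})$, $\widehat\delta_y^\sigma v_{ab}=\frac{1}{2h_\sigma}(v_{a,b+1}-v_{a,b-1})$, $\widehat\delta_h^\sigma=\widehat\delta_x^\sigma+\widehat\delta_y^\sigma$, $\delta_{xx}^\sigma v_{ab}=\frac1{h_\sigma^2}(v_{a+1,b}-2v_{ab}+v_{a-1,b})$,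 $\delta_{yy}^\sigma v_{ab}=\frac1{h_\sigma^2}(v_{a,b+1}-2v_{ab}+v_{a,b-1})$. With $(uv)_{ab}=u_{ab}v_{ab}$, the bilinear operators are $\psi_\ast^\sigma(u,v)_{ab}=\frac13\big(u_{ab}\widehat\delta_\ast^\sigma v_{ab}+\widehat\delta_\ast^\sigma(uv)_{ab}\big)$ for $\ast\in\{x,y,h\}$. **Step 1 (coarse nonlinear scheme).** $(u_c)^r,(v_c)^r,(w_c)^r\in\mathcal{V}_h^c$, $0\le r\le N^c$, solve, for all $(x_p,y_q)\in\Omega_h^c$, $$\delta_t^c(u_c)_{pq}^{r-\frac12}+\psi_h^c\big(u_c^{r-\frac12},u_c^{r-\frac12}\big)_{pq}-\frac{h_c^2}{2}\Big[\psi_x^c\big(v_c^{r-\frac12},u_c^{r-\frac12}\big)_{pq}+\psi_y^c\big(w_c^{r-\frac12},u_c^{r-\frac12}\big)_{pq}\Big]=\lambda\big((v_c)_{pq}^{r-\frac12}+(w_c)_{pq}^{r-\frac12}\big)\quad(1\le r\le N^c),$$ $(v_c)_{pq}^r=\delta_{xx}^c(u_c)_{pq}^r-\frac{h_c^2}{12}\delta_{xx}^c(v_c)_{pq}^r$ and $(w_c)_{pq}^r=\delta_{yy}^c(u_c)_{pq}^r-\frac{h_c^2}{12}\delta_{yy}^c(w_c)_{pq}^r$ for $0\le r\le N^c$, and $(u_c)_{pq}^0=u_0(x_p,y_q)$. **Step 2 (interpolation).** In time, at coarse spatial nodes: $(u_f)_{pk_h,qk_h}^{(r-1)k_\tau+s}=(1-\frac{s}{k_\tau})(u_c)_{pq}^{r-1}+\frac{s}{k_\tau}(u_c)_{pq}^r$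 for $1\le r\le N^c$, $0\le s\le k_\tau$. In space, for $0\le n\le N^f$, $0\le p\le M_1^c-1$, $0\le q\le M_2^c-1$, $0\le l,m\le k_h-1$: $$(u_f)_{pk_h+l,qk_h+m}^n=\sum_{i=0}^3\sum_{j=0}^3(u_f)_{(p+i)k_h,(q+j)k_h}^n\,\mu_i(x_{pk_h+l})\,\omega_j(y_{qk_h+m}),$$ $$\mu_i(x)=\prod_{0\le s\le3,\,s\ne i}\frac{x-x_{(p+s)k_h}}{x_{(p+i)k_h}-x_{(p+s)k_h}},\qquad \omega_j(y)=\prod_{0\le s\le3,\,s\ne j}\frac{y-y_{(q+s)k_h}}{y_{(q+j)k_h}-y_{(q+s)k_h}},$$ with fine-grid nodes $x_a=ah_f$, $y_b=bh_f$ and values extended periodically, so $u_f^n\in\mathcal{V}_h^f$. Then $v_f^n,w_f^n\in\mathcal{V}_h^f$ are defined by $(v_f)_{ij}^n=\delta_{xx}^f(u_f)_{ij}^n-\frac{h_f^2}{12}\delta_{xx}^f(v_f)_{ij}^n$ and $(w_f)_{ij}^n=\delta_{yy}^f(u_f)_{ij}^n-\frac{h_f^2}{12}\delta_{yy}^f(w_f)_{ij}^n$. *)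

(* Defs.v *)
From HB Require Import structures.
From mathcomp Require Import all_boot all_order all_algebra.
From mathcomp Require Import reals.

Set Implicit Arguments.
Unset Strict Implicit.
Unset Printing Implicit Defensive.

Import Order.TTheory GRing.Theory Num.Theory.
Local Open Scope ring_scope.

Section Defs.
Variable R : realType.

Definition gridfun := int -> int -> R.

Definition periodic (M1 M2 : nat) (v : gridfun) : Prop :=
  forall a b : int, v (a + M1%:Z) b = v a b /\ v a (b + M2%:Z) = v a b.

(* Index pairs (a, b) of the points (x_a, y_b) of Omega_h. *)
Definition in_Omega (M1 M2 : nat) (a b : int) : bool :=
  (1 <= a <= M1%:Z) && (1 <= b <= M2%:Z).

(* The coordinate x_a = a h; the same formula gives y_b. *)
Definition node (h : R) (a : int) : R := a%:~R * h.

(* [mean v d] and [delta_t tau v d] are the values at level d - 1/2; they are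
   only meaningful (and only used) for 1 <= d. *)
Definition mean (v : nat -> gridfun) (d : nat) : gridfun :=
  fun a b => (v d a b + v d.-1 a b) / 2.

Definition delta_t (tau : R) (v : nat -> gridfun) (d : nat) : gridfun :=
  fun a b => (v d a b - v d.-1 a b) / tau.

Definition hdelta_x (h : R) (v : gridfun) : gridfun :=
  fun a b => (v (a + 1) b - v (a - 1) b) / (2 * h).

Definition hdelta_y (h : R) (v : gridfun) : gridfun :=
  fun a b => (v a (b + 1) - v a (b - 1)) / (2 * h).

Definition hdelta_h (h : R) (v : gridfun) : gridfun :=
  fun a b => hdelta_x h v a b + hdelta_y h v a b.

Definition delta_xx (h : R) (v : gridfun) : gridfun :=
  fun a b => (v (a + 1) b - 2 * v a b + v (a - 1) b) / h ^+ 2.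

Definition delta_yy (h : R) (v : gridfun) : gridfun :=
  fun a b => (v a (b + 1) - 2 * v a b + v a (b - 1)) / h ^+ 2.

Definition psi (D : gridfun -> gridfun) (u v : gridfun) : gridfun :=
  fun a b => (u a b * D v a b + D (fun a' b' => u a' b' * v a' b') a b) / 3.

Definition psi_x (h : R) := psi (hdelta_x h).
Definition psi_y (h : R) := psi (hdelta_y h).
Definition psi_h (h : R) := psi (hdelta_h h).

(* v = D u - (h^2 / 12) D v on Omega_h, for D = delta_xx h or delta_yy h. *)
Definition compact_rel (M1 M2 : nat) (h : R) (D : gridfun -> gridfun)
    (u v : gridfun) : Prop :=
  forall a b : int, in_Omega M1 M2 a b ->
    v a b = D u a b - h ^+ 2 / 12 * D v a b.

(* (u, v, w) solves the difference scheme in which (U, V, W) occupies the first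
   slots of the bilinear operators. *)
Definition scheme (M1 M2 N : nat) (h tau lambda : R) (u0 : R -> R -> R)
    (U V W u v w : nat -> gridfun) : Prop :=
  [/\ forall n, (n <= N)%N ->
        [/\ periodic M1 M2 (u n), periodic M1 M2 (v n) & periodic M1 M2 (w n)],
      forall n, (1 <= n <= N)%N -> forall a b, in_Omega M1 M2 a b ->
        delta_t tau u n a b + psi_h h (mean U n) (mean u n) a b
          - h ^+ 2 / 2 * (psi_x h (mean V n) (mean u n) a b
                          + psi_y h (mean W n) (mean u n) a b)
        = lambda * (mean v n a b + mean w n a b),
      forall n, (n <= N)%N -> compact_rel M1 M2 h (delta_xx h) (u n) (v n),
      forall n, (n <= N)%N -> compact_rel M1 M2 h (delta_yy h) (u n) (w n)
    & forall a b, in_Omega M1 M2 a b -> u 0%N a b = u0 (node h a) (node h b)].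

(* The nonlinear scheme on the coarse grid: the unknowns also fill the first slots. *)
Definition coarse_scheme M1 M2 N h tau lambda u0 (u v w : nat -> gridfun) :=
  scheme M1 M2 N h tau lambda u0 u v w u v w.

Definition time_interp (M1c M2c Nc kh kt : nat) (uc uf : nat -> gridfun) : Prop :=
  forall r s : nat, (1 <= r <= Nc)%N -> (s <= kt)%N ->
  forall p q : int, in_Omega M1c M2c p q ->
    uf (r.-1 * kt + s)%N (p * kh%:Z) (q * kh%:Z) =
      (1 - s%:R / kt%:R) * uc r.-1 p q + s%:R / kt%:R * uc r p q.

(* The cubic Lagrange basis polynomial for the nodes of index (p + s) kh,
   0 <= s <= 3: mu_i in the x direction, omega_j in the y direction. *)
Definition lagrange (hf : R) (kh p : nat) (i : 'I_4) (x : R) : R :=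
  \prod_(s < 4 | s != i)
    ((x - node hf ((p + s) * kh)%N%:Z) /
     (node hf ((p + i) * kh)%N%:Z - node hf ((p + s) * kh)%N%:Z)).

Definition space_interp (M1c M2c Nf kh : nat) (hf : R) (uf : nat -> gridfun)
    : Prop :=
  forall n p q l m : nat,
    (n <= Nf)%N -> (p < M1c)%N -> (q < M2c)%N -> (l < kh)%N -> (m < kh)%N ->
    uf n (p * kh + l)%N%:Z (q * kh + m)%N%:Z =
      \sum_(i < 4) \sum_(j < 4)
        uf n ((p + i) * kh)%N%:Z ((q + j) * kh)%N%:Z
        * lagrange hf kh p i (node hf (p * kh + l)%N%:Z)
        * lagrange hf kh q j (node hf (q * kh + m)%N%:Z).

End Defs.

(* Main.v *)
(* For fixed first slots the convective part of the scheme is a skew-symmetric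
   linear operator of the unknown, and the compact relation v = A u - h^2/12 A v
   with a periodic second difference A gives (v, u) <= - h^2/6 |v|^2.  Hence at
   each time level the homogeneous linear system for (u, v, w) has only the zero
   solution (energy estimate), and in finite dimension injectivity gives unique
   solvability.  The initial level is the same system without convection and
   diffusion. *)
Require Import Defs.
From HB Require Import structures.
From mathcomp Require Import all_boot all_order all_algebra.
From mathcomp Require Import boolp reals.
From mathcomp Require Import ring lra.

Set Implicit Arguments.
Unset Strict Implicit.
Unset Printing Implicit Defensive.

Import Order.TTheory GRing.Theory Num.Theory.
Local Open Scope ring_scope.

(** * Linear algebra in finite dimension *)

Lemma injective_linear_surj (F : fieldType) (V : vectType F) (f : V -> V) :
  linear f -> (forall x, f x = 0 -> x = 0) -> forall y, exists x, f x = y.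
Proof.
move=> lin_f inj_f y.
pose g : {linear V -> V} := HB.pack f (GRing.isLinear.Build _ _ _ _ f lin_f).
have ker0 : lker (linfun g) == 0%VS.
  apply/lker0P => x1 x2; rewrite !lfunE /= => eq_f.
  apply/eqP; rewrite -subr_eq0; apply/eqP/inj_f.
  by rewrite -[f]/(g : V -> V) linearB /= eq_f subrr.
exists ((linfun g)^-1%VF y).
by rewrite -[RHS](lker0_lfunVK ker0) lfunE.
Qed.

(** * One-dimensional sums over a period *)

Section Cyclic.
Variables (R : realFieldType) (M : nat).
Implicit Types f : int -> R.

Lemma periodic_mulz f (k a : int) :
  (forall a, f (a + M%:Z) = f a) -> f (a + k * M%:Z) = f a.
Proof.
move=> fP; have pos (n : nat) b : f (b + n%:Z * M%:Z) = f b.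
  elim: n => [|n IHn]; first by rewrite mul0r addr0.
  by rewrite -addn1 PoszD mulrDl mul1r addrA fP.
case: k => n; first exact: pos.
by rewrite -(pos n.+1 (a + _)) NegzE mulNr subrK.
Qed.

Lemma periodic_modz f (a : int) :
  (forall a, f (a + M%:Z) = f a) -> f (a %% M%:Z)%Z = f a.
Proof.
by move=> fP; rewrite [in RHS](divz_eq a M%:Z) addrC periodic_mulz.
Qed.

(** The sum telescopes to f(M - 1) - f(-1), and these two values agree by periodicity. *)
Lemma sum_cyclic_diff f : (forall a, f (a + M%:Z) = f a) ->
  \sum_(i < M) (f i%:Z - f (i%:Z - 1)) = 0.
Proof.
move=> fP; pose g n := f (n%:Z - 1).
rewrite (eq_bigr (fun i : 'I_M => g i.+1 - g i)); last first.
  by move=> i _; rewrite /g -addn1 PoszD addrK.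
rewrite -(big_mkord xpredT (fun i => g i.+1 - g i)) telescope_sumr //.
by rewrite /g (addrC M%:Z) fP sub0r subrr.
Qed.

(* The summand is P(a) - P(a-1) with P(a) = (u_a + u_{a+1}) v_a v_{a+1}. *)
Lemma sum_skew (u v : int -> R) :
  (forall a, u (a + M%:Z) = u a) -> (forall a, v (a + M%:Z) = v a) ->
  \sum_(i < M) (u i%:Z * (v (i%:Z + 1) - v (i%:Z - 1))
     + (u (i%:Z + 1) * v (i%:Z + 1) - u (i%:Z - 1) * v (i%:Z - 1))) * v i%:Z
  = 0.
Proof.
move=> uP vP; pose P a := (u a + u (a + 1)) * v a * v (a + 1).
rewrite -[RHS](@sum_cyclic_diff P); last by move=> a; rewrite /P addrAC !uP !vP.
by apply: eq_bigr => i _; rewrite /P subrK; ring.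
Qed.

(* Put z = u - h^2/12 v, so that v is the second difference of z, and
   g(a) = z(a+1) - z(a).  Then h^2 (v u + h^2/6 v^2) = h^2 v z + h^4/4 v^2 is at
   most T(a) - T(a-1) with T = g z(.+1) - g^2/2, the defect being
   (g(a) + g(a-1))^2/4. *)
Lemma sum_compact_le (h : R) (u v : int -> R) : 0 < h ->
  (forall a, u (a + M%:Z) = u a) -> (forall a, v (a + M%:Z) = v a) ->
  (forall a, v a = (u (a + 1) - 2 * u a + u (a - 1)) / h ^+ 2
     - h ^+ 2 / 12 * ((v (a + 1) - 2 * v a + v (a - 1)) / h ^+ 2)) ->
  \sum_(i < M) v i%:Z * u i%:Z <= - (h ^+ 2 / 6) * \sum_(i < M) v i%:Z ^+ 2.
Proof.
move=> h0 uP vP vE; pose z a := u a - h ^+ 2 / 12 * v a.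
have vz a : v a * h ^+ 2 = z (a + 1) - 2 * z a + z (a - 1).
  by rewrite {1}vE /z; field; rewrite gt_eqF.
pose T a := (z (a + 1) - z a) * z (a + 1) - (z (a + 1) - z a) ^+ 2 / 2.
have TP a : T (a + M%:Z) = T a by rewrite /T /z (addrAC a) !uP !vP.
rewrite mulNr -subr_le0 opprK mulr_sumr -big_split /=.
rewrite -(pmulr_rle0 _ (exprn_gt0 2 h0)).
rewrite mulr_sumr -[leRHS](sum_cyclic_diff TP).
apply: ler_sum => i _; rewrite /T subrK.
have -> : u i = z i + h ^+ 2 / 12 * v i by rewrite /z; ring.
rewrite -subr_ge0.
set d := (X in 0 <= X).
have -> : d = (z (i%:Z + 1) - z (i%:Z - 1)) ^+ 2 / 4.
  rewrite /d; move: (vz i).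
  have -> : h ^+ 2 * (v i * (z i + h ^+ 2 / 12 * v i) + h ^+ 2 / 6 * v i ^+ 2)
    = (v i * h ^+ 2) * z i + (v i * h ^+ 2) ^+ 2 / 4 by field.
  by move=> ->; field.
by rewrite divr_ge0 ?sqr_ge0.
Qed.

End Cyclic.

(** * Periodic functions on the two-dimensional grid and the energy estimate *)

Section Grid.
Variables (R : realType) (M1 M2 : nat).
Implicit Types f g u v w : gridfun R.

Definition grid_sum f : R := \sum_(i < M1) \sum_(j < M2) f i%:Z j%:Z.

Lemma periodicl f b : periodic M1 M2 f -> forall a, f (a + M1%:Z) b = f a b.
Proof. by move=> fP a; case: (fP a b). Qed.

Lemma periodicr f a : periodic M1 M2 f -> forall b, f a (b + M2%:Z) = f a b.
Proof. by move=> fP b; case: (fP a b). Qed.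

Lemma periodic_modzz f (a b : int) : periodic M1 M2 f ->
  f (a %% M1%:Z)%Z (b %% M2%:Z)%Z = f a b.
Proof.
move=> fP; rewrite (@periodic_modz R M2 (f _)); last exact: periodicr.
by rewrite (@periodic_modz R M1 (fun a => f a b)) // => c; exact: periodicl.
Qed.

Lemma eq_in_Omega f g : (0 < M1)%N -> (0 < M2)%N ->
  periodic M1 M2 f -> periodic M1 M2 g ->
  (forall a b, in_Omega M1 M2 a b -> f a b = g a b) ->
  forall a b, f a b = g a b.
Proof.
move=> M1_gt0 M2_gt0 fP gP fg a b.
(* Residues start at 0 but the indices of Omega start at 1, so both functions are shifted by one
   before reducing modulo the period. *)
have shiftP (k : gridfun R) :
    periodic M1 M2 k -> periodic M1 M2 (fun a b => k (a + 1) (b + 1)).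
  by move=> kP a' b'; split; rewrite addrAC ?(periodicl _ kP) ?(periodicr _ kP).
have := periodic_modzz (a - 1) (b - 1) (shiftP _ fP).
have := periodic_modzz (a - 1) (b - 1) (shiftP _ gP).
rewrite !subrK => <- <-; apply: fg.
by rewrite /in_Omega !lerDr !lezD1 !modz_ge0 ?ltz_pmod ?lt0n_neq0.
Qed.

Lemma grid_sum_ge0_eq0 f : (forall a b, 0 <= f a b) -> grid_sum f <= 0 ->
  forall (i : 'I_M1) (j : 'I_M2), f i%:Z j%:Z = 0.
Proof.
move=> f_ge0 sum_le0 i j.
have row_ge0 (k : 'I_M1) : 0 <= \sum_(j < M2) f k%:Z j%:Z by apply: sumr_ge0.
have /eqP := le_anti (introT andP (conj sum_le0 (sumr_ge0 _ (fun k _ => row_ge0 k)))).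
rewrite psumr_eq0 // => /allP /(_ i (mem_index_enum i)) /=.
by rewrite psumr_eq0 // => /allP /(_ j (mem_index_enum j)) /= /eqP.
Qed.

(** The [psi] terms of the scheme with frozen first slots, isolated because they form a linear
    operator of [f] that is skew-symmetric on periodic functions. *)
Definition convection (h : R) (U V W f : gridfun R) : gridfun R := fun a b =>
  psi_h h U f a b - h ^+ 2 / 2 * (psi_x h V f a b + psi_y h W f a b).

(** As [psi] is linear in its first slot, the terms regroup into an x-part with coefficient U -
    h^2/2 V and a y-part with coefficient U - h^2/2 W. Each grid line then vanishes by [sum_skew];
    the factor 6h comes from the 1/3 in [psi] and the 1/(2h) in the central difference. *)
Lemma grid_sum_convection (h : R) U V W f : 0 < h ->
  periodic M1 M2 U -> periodic M1 M2 V -> periodic M1 M2 W ->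
  periodic M1 M2 f ->
  grid_sum (fun a b => convection h U V W f a b * f a b) = 0.
Proof.
move=> h_gt0 UP VP WP fP.
pose X a b := U a b - h ^+ 2 / 2 * V a b.
pose Y a b := U a b - h ^+ 2 / 2 * W a b.
pose Sx a b := (X a b * (f (a + 1) b - f (a - 1) b)
  + (X (a + 1) b * f (a + 1) b - X (a - 1) b * f (a - 1) b)) * f a b.
pose Sy a b := (Y a b * (f a (b + 1) - f a (b - 1))
  + (Y a (b + 1) * f a (b + 1) - Y a (b - 1) * f a (b - 1))) * f a b.
have -> : grid_sum (fun a b => convection h U V W f a b * f a b)
    = (6 * h)^-1 * (grid_sum Sx + grid_sum Sy).
  rewrite -big_split mulr_sumr; apply: eq_bigr => i _.
  rewrite -big_split mulr_sumr; apply: eq_bigr => j _ /=.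
  rewrite /convection /psi_h /psi_x /psi_y /psi /hdelta_h /hdelta_x /hdelta_y.
  by rewrite /Sx /Sy /X /Y; field; rewrite gt_eqF.
rewrite [X in X + _]exchange_big /= big1 ?add0r => [|j _]; last first.
  apply: (@sum_skew R M1 (fun a => X a j%:Z) (fun a => f a j%:Z)) => a.
    by rewrite /X !periodicl.
  by rewrite periodicl.
rewrite [X in _ * X]big1 ?mulr0 // => i _.
apply: (@sum_skew R M2 (Y i%:Z) (f i%:Z)) => b; last by rewrite periodicr.
by rewrite /Y !periodicr.
Qed.

Lemma grid_sum_compactx (h : R) u v : 0 < h ->
  periodic M1 M2 u -> periodic M1 M2 v ->
  (forall a b, v a b = delta_xx h u a b - h ^+ 2 / 12 * delta_xx h v a b) ->
  grid_sum (fun a b => v a b * u a b)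
    <= - (h ^+ 2 / 6) * grid_sum (fun a b => v a b ^+ 2).
Proof.
move=> h_gt0 uP vP vE; rewrite /grid_sum exchange_big [X in _ * X]exchange_big.
rewrite mulr_sumr; apply: ler_sum => j _.
apply: (@sum_compact_le R M1 h (u^~ j%:Z) (v^~ j%:Z)) => // a.
- by rewrite periodicl.
- by rewrite periodicl.
Qed.

Lemma grid_sum_compacty (h : R) u w : 0 < h ->
  periodic M1 M2 u -> periodic M1 M2 w ->
  (forall a b, w a b = delta_yy h u a b - h ^+ 2 / 12 * delta_yy h w a b) ->
  grid_sum (fun a b => w a b * u a b)
    <= - (h ^+ 2 / 6) * grid_sum (fun a b => w a b ^+ 2).
Proof.
move=> h_gt0 uP wP wE; rewrite /grid_sum.
rewrite mulr_sumr; apply: ler_sum => i _.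
apply: (@sum_compact_le R M2 h (u i%:Z) (w i%:Z)) => // b.
- by rewrite periodicr.
- by rewrite periodicr.
Qed.

Lemma periodic_delta_xx (h : R) f :
  periodic M1 M2 f -> periodic M1 M2 (delta_xx h f).
Proof.
move=> fP a b; rewrite /delta_xx !(addrAC a M1%:Z).
by rewrite !(periodicl _ fP) !(periodicr _ fP).
Qed.

Lemma periodic_delta_yy (h : R) f :
  periodic M1 M2 f -> periodic M1 M2 (delta_yy h f).
Proof.
move=> fP a b; rewrite /delta_yy !(addrAC b M2%:Z).
by rewrite !(periodicl _ fP) !(periodicr _ fP).
Qed.

Lemma periodic_convection (h : R) U V W f :
  periodic M1 M2 U -> periodic M1 M2 V -> periodic M1 M2 W ->
  periodic M1 M2 f -> periodic M1 M2 (convection h U V W f).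
Proof.
move=> UP VP WP fP a b; rewrite /convection /psi_h /psi_x /psi_y /psi.
rewrite /hdelta_h /hdelta_x /hdelta_y !(addrAC a M1%:Z) !(addrAC b M2%:Z).
rewrite !(periodicl _ fP) !(periodicl _ UP) !(periodicl _ VP) !(periodicl _ WP).
by rewrite !(periodicr _ fP) !(periodicr _ UP) !(periodicr _ VP) !(periodicr _ WP).
Qed.

(* Pairing the first equation with u gives
   |u|^2 = mu ((v, u) + (w, u)) <= - mu h^2/6 (|v|^2 + |w|^2). *)
Lemma homogeneous_eq0 (h mu kappa : R) U V W u v w :
  (0 < M1)%N -> (0 < M2)%N -> 0 < h -> 0 <= mu ->
  periodic M1 M2 U -> periodic M1 M2 V -> periodic M1 M2 W ->
  periodic M1 M2 u -> periodic M1 M2 v -> periodic M1 M2 w ->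
  (forall a b, in_Omega M1 M2 a b ->
     u a b + kappa * convection h U V W u a b = mu * (v a b + w a b)) ->
  compact_rel M1 M2 h (delta_xx h) u v ->
  compact_rel M1 M2 h (delta_yy h) u w ->
  forall a b, [/\ u a b = 0, v a b = 0 & w a b = 0].
Proof.
move=> M1_gt0 M2_gt0 h_gt0 mu_ge0 UP VP WP uP vP wP uE vE wE.
have zero f : periodic M1 M2 f -> grid_sum (fun a b => f a b ^+ 2) <= 0 ->
    forall a b, f a b = 0.
  move=> fP f_le0 a b; have lt_mod M (c : int) : (0 < M)%N ->
      exists i : 'I_M, (c %% M%:Z)%Z = i%:Z.
    move=> M_gt0; have M_neq0 : M%:Z != 0 by rewrite -lt0n.
    have c_lt : (`|(c %% M%:Z)%Z| < M)%N.
      by rewrite -ltz_nat gez0_abs ?modz_ge0 ?ltz_pmod.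
    by exists (Ordinal c_lt); rewrite /= gez0_abs ?modz_ge0.
  rewrite -(periodic_modzz a b fP).
  have [i ->] := lt_mod M1 a M1_gt0; have [j ->] := lt_mod M2 b M2_gt0.
  apply/eqP; rewrite -sqrf_eq0; apply/eqP.
  by apply: (grid_sum_ge0_eq0 _ f_le0) => *; exact: sqr_ge0.
(* The equations are given on Omega, but summation by parts also uses neighbours outside it;
   periodicity extends each equation to all indices. *)
have vE' : forall a b, v a b = delta_xx h u a b - h ^+ 2 / 12 * delta_xx h v a b.
  apply: (eq_in_Omega M1_gt0 M2_gt0 vP _ vE) => a b.
  have := periodic_delta_xx h uP a b; have := periodic_delta_xx h vP a b.
  by move=> [-> ->] [-> ->].
have wE' : forall a b, w a b = delta_yy h u a b - h ^+ 2 / 12 * delta_yy h w a b.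
  apply: (eq_in_Omega M1_gt0 M2_gt0 wP _ wE) => a b.
  have := periodic_delta_yy h uP a b; have := periodic_delta_yy h wP a b.
  by move=> [-> ->] [-> ->].
have uE' : forall a b, u a b = mu * (v a b + w a b) - kappa * convection h U V W u a b.
  apply: (eq_in_Omega M1_gt0 M2_gt0 uP) => a b; last first.
    by move=> /uE <-; rewrite addrK.
  have := periodic_convection h UP VP WP uP a b => -[-> ->].
  by rewrite !(periodicl _ vP) !(periodicl _ wP) !(periodicr _ vP) !(periodicr _ wP).
have vu_le := grid_sum_compactx h_gt0 uP vP vE'.
have wu_le := grid_sum_compacty h_gt0 uP wP wE'.
have sqr_sum_ge0 f : 0 <= grid_sum (fun a b => f a b ^+ 2).
  by do 2![apply: sumr_ge0 => ? _]; exact: sqr_ge0.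
have h2_gt0 : 0 < h ^+ 2 / 6 by rewrite divr_gt0 ?exprn_gt0.
have u_eq0 : forall a b, u a b = 0.
  apply: zero => //.
  have -> : grid_sum (fun a b => u a b ^+ 2)
      = mu * (grid_sum (fun a b => v a b * u a b)
              + grid_sum (fun a b => w a b * u a b))
        - kappa * grid_sum (fun a b => convection h U V W u a b * u a b).
    rewrite -big_split /= !mulr_sumr -sumrB; apply: eq_bigr => i _.
    rewrite -big_split /= !mulr_sumr -sumrB; apply: eq_bigr => j _.
    by rewrite expr2 {1}uE' /=; ring.
  rewrite grid_sum_convection // mulr0 subr0 mulr_ge0_le0 //.
  rewrite -[leRHS]addr0 lerD //.
    by rewrite (le_trans vu_le) // mulNr oppr_le0 mulr_ge0 // ltW.
  by rewrite (le_trans wu_le) // mulNr oppr_le0 mulr_ge0 // ltW.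
(* With u = 0 the compact estimates read 0 <= - h^2/6 |v|^2 and likewise for w, which forces both to
   vanish. *)
have pair0 f : grid_sum (fun a b => f a b * u a b) = 0.
  by do 2![rewrite /grid_sum big1 // => ? _]; rewrite u_eq0 mulr0.
move=> a b; split; rewrite ?u_eq0 //.
- by apply: zero => //; move: vu_le; rewrite pair0 mulNr oppr_ge0 pmulr_rle0.
- by apply: zero => //; move: wu_le; rewrite pair0 mulNr oppr_ge0 pmulr_rle0.
Qed.

End Grid.

(** * Periodic grid functions as matrices *)

Section Extension.
Variables (R : realType) (M1 M2 : nat).
Local Notation M := 'M[R]_(M1.+1, M2.+1).

(** The matrix stores one period, counted from 0. A residue is below the modulus, so [inord] never
    takes its default value. *)
Definition periodic_ext (m : M) : gridfun R := fun a b =>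
  m (inord `|(a %% M1.+1%:Z)%Z|) (inord `|(b %% M2.+1%:Z)%Z|).

Lemma periodic_extP m : periodic M1.+1 M2.+1 (periodic_ext m).
Proof. by move=> a b; rewrite /periodic_ext !modzDr. Qed.

Lemma periodic_ext_ord m (i : 'I_M1.+1) (j : 'I_M2.+1) :
  periodic_ext m i%:Z j%:Z = m i j.
Proof. by rewrite /periodic_ext !modz_nat !modn_small // !inord_val. Qed.

Lemma periodic_extD (c : R) m1 m2 a b :
  periodic_ext (c *: m1 + m2) a b = c * periodic_ext m1 a b + periodic_ext m2 a b.
Proof. by rewrite /periodic_ext !mxE. Qed.

(** The shift by one matches the indexing of Omega. This map records the equations while
    [periodic_ext] encodes the unknowns, one entry per point of a period in both cases, so the
    resulting system is square. *)
Definition Omega_mx (f : gridfun R) : M :=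
  \matrix_(i, j) f (i%:Z + 1) (j%:Z + 1).

Lemma Omega_mxP (f g : gridfun R) : Omega_mx f = Omega_mx g ->
  forall a b, in_Omega M1.+1 M2.+1 a b -> f a b = g a b.
Proof.
move=> /matrixP fg a b /andP[/andP[a1 aM] /andP[b1 bM]].
have ord K c : 1 <= c -> c <= K.+1%:Z -> exists i : 'I_K.+1, c = i%:Z + 1.
  case: c => [[|c]|] // _ cK; exists (inord c).
  by rewrite inordK // -addn1.
have [i ->] := ord _ _ a1 aM; have [j ->] := ord _ _ b1 bM.
by have := fg i j; rewrite !mxE.
Qed.

End Extension.

(** * Solvability at a single time level *)

Section Scheme.
Variables (R : realType) (M1 M2 : nat).
Hypotheses (M1_gt0 : (0 < M1)%N) (M2_gt0 : (0 < M2)%N).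

(** Three unknowns and three equations per grid point give a square linear system, whose kernel is
    trivial by [homogeneous_eq0]. Keeping [mu] and [kappa] free covers both a time step and the
    initial level. *)
Lemma grid_solvable (h mu kappa : R) (U V W F : gridfun R) :
  0 < h -> 0 <= mu ->
  periodic M1 M2 U -> periodic M1 M2 V -> periodic M1 M2 W ->
  exists s : gridfun R * gridfun R * gridfun R,
  [/\ [/\ periodic M1 M2 s.1.1, periodic M1 M2 s.1.2 & periodic M1 M2 s.2],
      forall a b, in_Omega M1 M2 a b ->
        s.1.1 a b + kappa * convection h U V W s.1.1 a b
        = mu * (s.1.2 a b + s.2 a b) + F a b,
      compact_rel M1 M2 h (delta_xx h) s.1.1 s.1.2
    & compact_rel M1 M2 h (delta_yy h) s.1.1 s.2].
Proof.
move: M1_gt0 M2_gt0; case: M1 => // m1; case: M2 => // m2 _ _.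
move=> h_gt0 mu_ge0 UP VP WP.
pose E := @periodic_ext R m1 m2.
pose X := ('M[R]_(m1.+1, m2.+1) * 'M[R]_(m1.+1, m2.+1) * 'M[R]_(m1.+1, m2.+1))%type.
(* [Phi] collects the residuals of the three equations, the source [F] being left out so that the
   map is linear. *)
pose Phi (x : X) : X :=
  (Omega_mx m1 m2 (fun a b => E x.1.1 a b
      + kappa * convection h U V W (E x.1.1) a b
      - mu * (E x.1.2 a b + E x.2 a b)),
   Omega_mx m1 m2 (fun a b => E x.1.2 a b
      - (delta_xx h (E x.1.1) a b - h ^+ 2 / 12 * delta_xx h (E x.1.2) a b)),
   Omega_mx m1 m2 (fun a b => E x.2 a b
      - (delta_yy h (E x.1.1) a b - h ^+ 2 / 12 * delta_yy h (E x.2) a b))).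
have Phi_lin : linear Phi.
  move=> c [[u1 v1] w1] [[u2 v2] w2].
  congr (_, _, _); apply/matrixP => i j; rewrite !mxE /=.
  - rewrite /convection /psi_h /psi_x /psi_y /psi /hdelta_h /hdelta_x /hdelta_y.
    by rewrite /E !periodic_extD; ring.
  - by rewrite /delta_xx /E !periodic_extD; ring.
  - by rewrite /delta_yy /E !periodic_extD; ring.
(* Used twice: with zero source for injectivity, and with source [F] for the solution itself. *)
have PhiE x G : Phi x = (Omega_mx m1 m2 G, 0, 0) ->
    [/\ forall a b, in_Omega m1.+1 m2.+1 a b ->
        E x.1.1 a b + kappa * convection h U V W (E x.1.1) a b
        = mu * (E x.1.2 a b + E x.2 a b) + G a b,
      compact_rel m1.+1 m2.+1 h (delta_xx h) (E x.1.1) (E x.1.2)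
    & compact_rel m1.+1 m2.+1 h (delta_yy h) (E x.1.1) (E x.2)].
  have -> : (0 : 'M[R]_(m1.+1, m2.+1)) = Omega_mx m1 m2 (fun _ _ => 0).
    by apply/matrixP => i j; rewrite !mxE.
  move=> [/Omega_mxP uE /Omega_mxP vE /Omega_mxP wE]; split=> a b ab.
  - by rewrite [RHS]addrC; apply/eqP; rewrite -subr_eq uE.
  - by apply/eqP; rewrite -subr_eq0 vE.
  - by apply/eqP; rewrite -subr_eq0 wE.
have Phi_inj x : Phi x = 0 -> x = 0.
  move=> Phi0; have [|uE vE wE] := PhiE x (fun _ _ => 0).
    by rewrite Phi0; congr (_, _, _); apply/matrixP => i j; rewrite !mxE.
  have E0 := homogeneous_eq0 (isT : 0 < m1.+1)%N (isT : 0 < m2.+1)%N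
    h_gt0 mu_ge0 UP VP WP (periodic_extP _) (periodic_extP _) (periodic_extP _) _ vE wE.
  have {}E0 := E0 kappa (fun a b ab => etrans (uE a b ab) (addr0 _)).
  case: x Phi0 uE vE wE E0 => [[u v] w] /= _ _ _ _ E0.
  by congr (_, _, _); apply/matrixP => i j; have [] := E0 i%:Z j%:Z;
    rewrite !periodic_ext_ord mxE.
have [x xE] := injective_linear_surj Phi_lin Phi_inj (Omega_mx m1 m2 F, 0, 0).
have [uE vE wE] := PhiE _ _ xE.
by exists (E x.1.1, E x.1.2, E x.2); split => //; split; exact: periodic_extP.
Qed.

(** * Marching through the time levels *)

Variables (N : nat) (h tau lambda : R) (u0 : R -> R -> R) (U V W : nat -> gridfun R).
Hypotheses (h_gt0 : 0 < h) (tau_gt0 : 0 < tau) (lambda_gt0 : 0 < lambda).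
Hypothesis UP : forall n, (n <= N)%N -> periodic M1 M2 (U n).
Hypothesis VP : forall n, (n <= N)%N -> periodic M1 M2 (V n).
Hypothesis WP : forall n, (n <= N)%N -> periodic M1 M2 (W n).

Lemma periodic_mean (f : nat -> gridfun R) n :
  (forall n, (n <= N)%N -> periodic M1 M2 (f n)) ->
  (n.+1 <= N)%N -> periodic M1 M2 (mean f n.+1).
Proof.
move=> fP nN a b; rewrite /mean /=.
by have [-> ->] := fP _ nN a b; have [-> ->] := fP _ (ltnW nN) a b.
Qed.

Let conv n := convection h (mean U n) (mean V n) (mean W n).

Lemma convection_mean (u : nat -> gridfun R) n k a b :
  conv n (mean u k) a b = (conv n (u k) a b + conv n (u k.-1) a b) / 2.
Proof.
rewrite /conv /convection /psi_h /psi_x /psi_y /psi /hdelta_h /hdelta_x /hdelta_y.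
by rewrite /(mean u); field; rewrite gt_eqF.
Qed.

(** Multiplying by [tau] and splitting the half-level means by linearity isolates level [n.+1] on
    the left. This is the form of [grid_solvable] with kappa = tau/2 and mu = tau/2 * lambda, the
    source being built from level [n]. *)
Lemma scheme_stepE (u v w : nat -> gridfun R) n a b :
  (delta_t tau u n.+1 a b + psi_h h (mean U n.+1) (mean u n.+1) a b
    - h ^+ 2 / 2 * (psi_x h (mean V n.+1) (mean u n.+1) a b
                    + psi_y h (mean W n.+1) (mean u n.+1) a b)
   = lambda * (mean v n.+1 a b + mean w n.+1 a b)) <->
  (u n.+1 a b + tau / 2 * conv n.+1 (u n.+1) a b
   = tau / 2 * lambda * (v n.+1 a b + w n.+1 a b)
     + (u n a b - tau / 2 * conv n.+1 (u n) a b
        + tau / 2 * lambda * (v n a b + w n a b))).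
Proof.
have := convection_mean u n.+1 n.+1 a b; rewrite {1}/conv /convection /=.
move=> /(canRL (subrK _)) ->; rewrite -addrA addrK /delta_t /mean /=.
have tau_neq0 : tau != 0 by rewrite gt_eqF.
(* The two equations differ by the factor [tau], so each direction rescales the goal and matches its
   residual with that of the hypothesis. *)
split => [E|E].
- apply: (mulIf (invr_neq0 tau_neq0)); apply/eqP; rewrite -subr_eq0; apply/eqP.
  by move/eqP: E; rewrite -subr_eq0 => /eqP <-; field.
- apply: (mulIf tau_neq0); apply/eqP; rewrite -subr_eq0; apply/eqP.
  by move/eqP: E; rewrite -subr_eq0 => /eqP <-; field.
Qed.

Let mu_ge0 : 0 <= tau / 2 * lambda.
Proof. by rewrite ltW ?mulr_gt0 ?invr_gt0. Qed.

Lemma scheme_exists :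
  exists u v w, scheme M1 M2 N h tau lambda u0 U V W u v w.
Proof.
pose S := (gridfun R * gridfun R * gridfun R)%type.
pose good (s : S) :=
  [/\ [/\ periodic M1 M2 s.1.1, periodic M1 M2 s.1.2 & periodic M1 M2 s.2],
      compact_rel M1 M2 h (delta_xx h) s.1.1 s.1.2
    & compact_rel M1 M2 h (delta_yy h) s.1.1 s.2].
have zeroP : periodic M1 M2 (fun _ _ => 0 : R) by [].
(* With mu = kappa = 0 the first equation reduces to the initial condition, while the compact
   relations still determine v and w. *)
have [s0 [s0P s0E s0v s0w]] := grid_solvable 0
  (fun a b => u0 (node h a) (node h b)) h_gt0 (lexx 0) zeroP zeroP zeroP.
(* The condition is vacuous past level [N], which makes the step relation total, as [choice]
   requires. *)
pose next (x : nat * S) (s : S) := (x.1.+1 <= N)%N -> good s /\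
  forall a b, in_Omega M1 M2 a b ->
    s.1.1 a b + tau / 2 * conv x.1.+1 s.1.1 a b
    = tau / 2 * lambda * (s.1.2 a b + s.2 a b)
      + (x.2.1.1 a b - tau / 2 * conv x.1.+1 x.2.1.1 a b
         + tau / 2 * lambda * (x.2.1.2 a b + x.2.2 a b)).
have /choice[step stepP] : forall x, exists s, next x s.
  move=> [n s]; have [nN|nN] := boolP (n.+1 <= N)%N; last first.
    by exists s; rewrite /next (negPf nN).
  have [s' [s'P s'E s'v s'w]] := grid_solvable (tau / 2)
    (fun a b => s.1.1 a b - tau / 2 * conv n.+1 s.1.1 a b
         + tau / 2 * lambda * (s.1.2 a b + s.2 a b)) h_gt0 mu_ge0
    (periodic_mean UP nN) (periodic_mean VP nN) (periodic_mean WP nN).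
  by exists s' => _; split.
pose seq_s := fix seq_s n := if n is k.+1 then step (k, seq_s k) else s0.
have seq_good n : (n <= N)%N -> good (seq_s n).
  by case: n => [|n] nN //; have [] := stepP (n, seq_s n) nN.
exists (fun n => (seq_s n).1.1), (fun n => (seq_s n).1.2), (fun n => (seq_s n).2).
split => [n /seq_good[] //|[//|n] /andP[_ nN] a b ab
  |n /seq_good[] //|n /seq_good[] //|a b ab].
  by apply/scheme_stepE; have [_] := stepP (n, seq_s n) nN; apply.
by have := s0E a b ab; rewrite !mul0r addr0 add0r.
Qed.

(** Induction on the level: once two solutions agree at level [n], the sources at [n.+1] coincide,
    so their difference solves the homogeneous system. *)
Lemma scheme_unique u v w u' v' w' :
  scheme M1 M2 N h tau lambda u0 U V W u v w ->
  scheme M1 M2 N h tau lambda u0 U V W u' v' w' ->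
  forall n, (n <= N)%N -> forall a b : int,
    [/\ u' n a b = u n a b, v' n a b = v n a b & w' n a b = w n a b].
Proof.
move=> [sP sE sv sw s0] [sP' sE' sv' sw' s0'].
pose D (f f' : nat -> gridfun R) n : gridfun R := fun a b => f' n a b - f n a b.
have DP (f f' : nat -> gridfun R) n : periodic M1 M2 (f n) -> periodic M1 M2 (f' n) ->
    periodic M1 M2 (D f f' n).
  by move=> fP f'P a b; rewrite /D; have [-> ->] := fP a b; have [-> ->] := f'P a b.
have D0 n (mu kappa : R) X Y Z : (n <= N)%N -> 0 <= mu ->
    periodic M1 M2 X -> periodic M1 M2 Y -> periodic M1 M2 Z ->
    (forall a b, in_Omega M1 M2 a b ->
      D u u' n a b + kappa * convection h X Y Z (D u u' n) a b
      = mu * (D v v' n a b + D w w' n a b)) ->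
    forall a b, [/\ u' n a b = u n a b, v' n a b = v n a b & w' n a b = w n a b].
  move=> nN mu0 XP YP ZP E a b; have [uP vP wP] := sP n nN.
  have [uP' vP' wP'] := sP' n nN.
  have cv : compact_rel M1 M2 h (delta_xx h) (D u u' n) (D v v' n).
    by move=> c d cd; rewrite /D sv // sv' // /delta_xx; ring.
  have cw : compact_rel M1 M2 h (delta_yy h) (D u u' n) (D w w' n).
    by move=> c d cd; rewrite /D sw // sw' // /delta_yy; ring.
  have [] := homogeneous_eq0 M1_gt0 M2_gt0 h_gt0 mu0 XP YP ZP
    (DP _ _ _ uP uP') (DP _ _ _ vP vP') (DP _ _ _ wP wP') E cv cw a b.
  by rewrite /D => /subr0_eq ? /subr0_eq ? /subr0_eq.
elim=> [|n IHn] nN.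
  apply: (D0 _ 0 0 (fun _ _ => 0) (fun _ _ => 0) (fun _ _ => 0)) => // a b ab.
  by rewrite /D s0 // s0' // !mul0r subrr addr0.
apply: (D0 _ _ (tau / 2) _ _ _ nN mu_ge0
  (periodic_mean UP nN) (periodic_mean VP nN) (periodic_mean WP nN)) => a b ab.
have /scheme_stepE E := sE n.+1 nN a b ab.
have /scheme_stepE E' := sE' n.+1 nN a b ab.
have IH c d : [/\ u' n c d = u n c d, v' n c d = v n c d & w' n c d = w n c d].
  exact: IHn (ltnW nN) c d.
have [uu vv ww] := IH a b.
(* The convection at a point involves neighbouring values, so equality of whole functions is needed
   to rewrite inside it. *)
have uuE : u' n = u n by apply/funext => c; apply/funext => d; have [] := IH c d.
have -> : convection h (mean U n.+1) (mean V n.+1) (mean W n.+1) (D u u' n.+1) a b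
   = conv n.+1 (u' n.+1) a b - conv n.+1 (u n.+1) a b.
  rewrite /conv /convection /psi_h /psi_x /psi_y /psi /hdelta_h /hdelta_x /hdelta_y /D.
  by field; rewrite gt_eqF.
move: E'; rewrite vv ww uuE => E'; rewrite /D.
by lra.
Qed.

End Scheme.

(** With [uf], [vf], [wf] frozen in the first slots the fine scheme is linear with periodic
    coefficients, so the level-by-level results apply once the fine steps and sizes are shown
    positive. Sequences are indexed by all naturals but constrained only up to [Nf], hence the range
    in the uniqueness claim. *)
Theorem theorem4p1 (R : realType) (lambda T L1 L2 : R) (u0 : R -> R -> R)
  (M1c M2c Nc kh kt M1f M2f Nf : nat) (hc tauc hf tauf : R)
  (uc vc wc uf vf wf : nat -> gridfun R)
  (lambda_gt0 : 0 < lambda) (T_gt0 : 0 < T) (L1_gt0 : 0 < L1) (L2_gt0 : 0 < L2)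
  (M1c_gt0 : (0 < M1c)%N) (M2c_gt0 : (0 < M2c)%N) (Nc_gt0 : (0 < Nc)%N)
  (kh_gt0 : (0 < kh)%N) (kt_gt0 : (0 < kt)%N)
  (hc_gt0 : 0 < hc) (L1E : L1 = hc * M1c%:R) (L2E : L2 = hc * M2c%:R)
  (taucE : tauc = T / Nc%:R) (hfE : hf = hc / kh%:R) (taufE : tauf = tauc / kt%:R)
  (M1fE : M1f = (kh * M1c)%N) (M2fE : M2f = (kh * M2c)%N) (NfE : Nf = (kt * Nc)%N)
  (step1 : coarse_scheme M1c M2c Nc hc tauc lambda u0 uc vc wc)
  (uf_periodic : forall n, (n <= Nf)%N -> periodic M1f M2f (uf n))
  (step2_time : time_interp M1c M2c Nc kh kt uc uf)
  (step2_space : space_interp M1c M2c Nf kh hf uf)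
  (vf_periodic : forall n, (n <= Nf)%N -> periodic M1f M2f (vf n))
  (wf_periodic : forall n, (n <= Nf)%N -> periodic M1f M2f (wf n))
  (vfE : forall n, (n <= Nf)%N -> compact_rel M1f M2f hf (delta_xx hf) (uf n) (vf n))
  (wfE : forall n, (n <= Nf)%N -> compact_rel M1f M2f hf (delta_yy hf) (uf n) (wf n)) :
  exists u v w : nat -> gridfun R,
    scheme M1f M2f Nf hf tauf lambda u0 uf vf wf u v w /\
    forall u' v' w' : nat -> gridfun R,
      scheme M1f M2f Nf hf tauf lambda u0 uf vf wf u' v' w' ->
      forall n, (n <= Nf)%N -> forall a b : int,
        [/\ u' n a b = u n a b, v' n a b = v n a b & w' n a b = w n a b].
Proof.
have hf_gt0 : 0 < hf by rewrite hfE divr_gt0 ?ltr0n.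
have tauf_gt0 : 0 < tauf by rewrite taufE taucE !divr_gt0 ?ltr0n.
have M1f_gt0 : (0 < M1f)%N by rewrite M1fE muln_gt0 kh_gt0.
have M2f_gt0 : (0 < M2f)%N by rewrite M2fE muln_gt0 kh_gt0.
have [u [v [w uvw]]] := scheme_exists M1f_gt0 M2f_gt0 u0 hf_gt0 tauf_gt0
  lambda_gt0 uf_periodic vf_periodic wf_periodic.
exists u, v, w; split=> // u' v' w'; exact: (scheme_unique M1f_gt0 M2f_gt0 hf_gt0
  tauf_gt0 lambda_gt0 uf_periodic vf_periodic wf_periodic uvw).
Qed.
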